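(* The conditional operator on Church numerals is not definable in the safe lambda calculus: there is no closed safe lambda-term $C$ of type $I\to I\to I\to I$ such that for all terms $t,y,z$ of type $I$: $C\,t\,y\,z$ $\beta$-reduces to $y$ whenever $t$ $\beta$-reduces to $\overline{0}$, and $C\,t\,y\,z$ $\beta$-reduces to $z$ whenever $t$ $\beta$-reduces to $\overline{n+1}$ for some $n\in\mathbb{N}$.
   Context: Simple types are generated by $A ::= o \mid A \to A$ ($\to$ associates to the right); $(A_1,\ldots,A_n,B)$ abbreviates $A_1\to\cdots\to A_n\to B$. Orders: $\mathrm{ord}(o)=0$, $\mathrm{ord}(A\to B)=\max(\mathrm{ord}(A)+1,\mathrm{ord}(B))$. Terms are Church-style terms built from typed variables, without constants. The order of a term or variable is the order of its type. ''$\beta$-reduces'' means in zero or more steps. Safe lambda calculus. Judgements $\Gamma\vdash_{\sf s} M:A$ and $\Gamma\vdash_{\sf asa} M:A$ are defined by mutual induction. ''$c\le \mathrm{ord}\,\Gamma$'' means $c\le \mathrm{ord}(y)$ for every $y\in\Gamma$. (var) $x:A\vdash_{\sf s}x:A$. (wk) from $\Gamma\vdash_{\sf s}M:A$ infer $\Delta\vdash_{\sf s}M:A$ if $\Gamma\subset\Delta$. ($\delta$) from $\Gamma\vdash_{\sf s}M:A$ infer $\Gamma\vdash_{\sf asa}M:A$. (app$_{as}$) from $\Gamma\vdash_{\sf asa}M:A\to B$ and $\Gamma\vdash_{\sf s}N:A$ infer $\Gamma\vdash_{\sf asa}MN:B$. (app) from $\Gamma\vdash_{\sf asa}M:A\to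 B$ and $\Gamma\vdash_{\sf s}N:A$ infer $\Gamma\vdash_{\sf s}MN:B$, provided $\mathrm{ord}(B)\le\mathrm{ord}\,\Gamma$. (abs) from $\Gamma,x_1:A_1,\ldots,x_n:A_n\vdash_{\sf asa}M:B$ infer $\Gamma\vdash_{\sf s}\lambda x_1^{A_1}\ldots x_n^{A_n}.M:(A_1,\ldots,A_n,B)$, provided $\mathrm{ord}(A_1,\ldots,A_n,B)\le\mathrm{ord}\,\Gamma$. A term $M$ is safe if $\Gamma\vdash_{\sf s}M:T$ is derivable for some $\Gamma,T$. Church numerals: $I=((o,o),o,o)$ and $\overline{n}=\lambda s^{(o,o)}z^o.s^n z$ of type $I$ for $n\in\mathbb{N}$. *)

(* Defs.v *)
From mathcomp Require Import all_boot.
From Stdlib Require Import Relation_Operators.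

Set Implicit Arguments.
Unset Strict Implicit.
Unset Printing Implicit Defensive.

Inductive type : Type :=
| Base
| Arr of type & type.

Fixpoint ord (A : type) : nat :=
  if A is Arr B C then maxn (ord B).+1 (ord C) else 0.

(* (A_1, ..., A_n, B) = A_1 -> ... -> A_n -> B *)
Definition arrs (As : seq type) (B : type) : type := foldr Arr B As.

(* Terms are taken up to alpha-equivalence by using de Bruijn indices. *)
Inductive term : Type :=
| Var of nat
| App of term & term
| Lam of type & term.

Definition lams (As : seq type) (M : term) : term := foldr Lam M As.

(* A context is a finite set of typed variables, encoded as a finite partial
   map from indices to types: an index whose entry is None is not declared.
   The gaps let a context be extended by plain inclusion, as with named
   variables, without renaming the term. *)
Definition context : Type := seq (option type).

Definition lookup (G : context) (x : nat) : option type := nth None G x.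

Definition subctx (G D : context) : Prop :=
  forall x A, lookup G x = Some A -> lookup D x = Some A.

Definition singleton_ctx (x : nat) (A : type) : context :=
  rcons (nseq x None) (Some A).

(* G, x_1 : A_1, ..., x_n : A_n where x_n is the innermost bound variable, so
   it gets index 0. *)
Definition extend (G : context) (As : seq type) : context :=
  map Some (rev As) ++ G.

Definition le_ord_ctx (c : nat) (G : context) : Prop :=
  forall x A, lookup G x = Some A -> c <= ord A.

Inductive has_type : context -> term -> type -> Prop :=
| ht_var G x A :
    lookup G x = Some A -> has_type G (Var x) A
| ht_app G M N A B :
    has_type G M (Arr A B) -> has_type G N A -> has_type G (App M N) B
| ht_lam G A M B :
    has_type (Some A :: G) M B -> has_type G (Lam A M) (Arr A B).

Definition up_ren (r : nat -> nat) (x : nat) : nat :=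
  if x is y.+1 then (r y).+1 else 0.

Fixpoint rename (r : nat -> nat) (M : term) : term :=
  match M with
  | Var x => Var (r x)
  | App P Q => App (rename r P) (rename r Q)
  | Lam A P => Lam A (rename (up_ren r) P)
  end.

Definition up_sub (s : nat -> term) (x : nat) : term :=
  if x is y.+1 then rename succn (s y) else Var 0.

Fixpoint substitute (s : nat -> term) (M : term) : term :=
  match M with
  | Var x => s x
  | App P Q => App (substitute s P) (substitute s Q)
  | Lam A P => Lam A (substitute (up_sub s) P)
  end.

Definition substitute0 (M N : term) : term :=
  substitute (fun x => if x is y.+1 then Var y else N) M.

Inductive beta_step : term -> term -> Prop :=
| beta_redex A M N : beta_step (App (Lam A M) N) (substitute0 M N)
| beta_appl M M' N : beta_step M M' -> beta_step (App M N) (App M' N)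
| beta_appr M N N' : beta_step N N' -> beta_step (App M N) (App M N')
| beta_lam A M M' : beta_step M M' -> beta_step (Lam A M) (Lam A M').

Definition beta_reduces : term -> term -> Prop := clos_refl_trans term beta_step.

(* In safe_abs, the degenerate case As = [::] derives no new judgement: asa
   judgements come from asa_delta or asa_app, and under the side condition
   the latter's conclusion is obtained by safe_app. *)
Inductive safe : context -> term -> type -> Prop :=
| safe_var x A :
    safe (singleton_ctx x A) (Var x) A
| safe_wk G D M A :
    safe G M A -> subctx G D -> safe D M A
| safe_app G M N A B :
    asafe G M (Arr A B) -> safe G N A ->
    le_ord_ctx (ord B) G -> safe G (App M N) B
| safe_abs G As M B :
    asafe (extend G As) M B ->
    le_ord_ctx (ord (arrs As B)) G -> safe G (lams As M) (arrs As B)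
with asafe : context -> term -> type -> Prop :=
| asa_delta G M A :
    safe G M A -> asafe G M A
| asa_app G M N A B :
    asafe G M (Arr A B) -> safe G N A -> asafe G (App M N) B.

Definition safe_term (M : term) : Prop := exists G A, safe G M A.

Definition nat_type : type := arrs [:: Arr Base Base; Base] Base.

Definition numeral (n : nat) : term :=
  lams [:: Arr Base Base; Base] (iter n (App (Var 1)) (Var 0)).

(* Main.v *)
Require Import Defs.
From mathcomp Require Import all_boot.
From Stdlib Require Import Relation_Operators FunctionalExtensionality Eqdep_dec.

Set Implicit Arguments.
Unset Strict Implicit.
Unset Printing Implicit Defensive.

(* Interpret the base type by the booleans and arrows by full function spaces.
   In a safe term of order at least 1 no ground variable is free, so its value
   does not depend on ground data. Hence it respects a Kripke logical relation
   with two worlds, in which the relation at the base type is equality or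
   negation, and in which elements of higher order must be related in both
   worlds at once. A function on booleans related to itself then commutes with
   negation, so it is the identity or negation and its square is the identity.
   Thus the numerals 0 and 2 are related, and a safe conditional C maps them to
   related values C 0 0 1 = 0 and C 2 0 1 = 1; but the numerals 0 and 1 differ
   at negation. *)

(** * The boolean model and the evaluation of terms *)

Fixpoint den (A : type) : Type :=
  if A is Arr B C then den B -> den C else bool.

Fixpoint dflt (A : type) : den A :=
  match A with Base => true | Arr _ C => fun _ => dflt C end.

Definition type_eq_dec (A B : type) : {A = B} + {A <> B}.
Proof. decide equality. Defined.

(** Values carry their type so that [eval] is total on raw terms; [coerce] resolves a type mismatch
    by [dflt]. *)
Definition val : Type := {A : type & den A}.

Definition val_type (v : val) : type := projT1 v.

Definition mkval A (a : den A) : val := existT den A a.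

Definition coerce (A : type) (v : val) : den A :=
  match type_eq_dec (projT1 v) A with
  | left e => eq_rect _ den (projT2 v) _ e
  | right _ => dflt A
  end.

Definition apply (v w : val) : val :=
  match v with
  | existT (Arr A B) f => mkval (f (coerce A w) : den B)
  | v => v
  end.

Definition scons (T : Type) (a : T) (e : nat -> T) (x : nat) : T :=
  if x is y.+1 then e y else a.

(* The type of the body of an abstraction is read off at the default argument;
   on well-typed terms it does not depend on the argument. *)
Fixpoint eval (M : term) (e : nat -> val) : val :=
  match M with
  | Var x => e x
  | App P Q => apply (eval P e) (eval Q e)
  | Lam A P =>
      let B := val_type (eval P (scons (mkval (dflt A)) e)) in
      @mkval (Arr A B) (fun a : den A => coerce B (eval P (scons (mkval a) e)))
  end.

Lemma coerce_mkval A (a : den A) : coerce A (mkval a) = a.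
Proof.
rewrite /coerce /=; case: (type_eq_dec A A) => // e.
by rewrite (UIP_dec type_eq_dec e (erefl A)).
Qed.

Lemma mkval_coerce A v : val_type v = A -> mkval (coerce A v) = v.
Proof. by case: v => B b /= <-; rewrite coerce_mkval. Qed.

Lemma eval_rename M r e : eval (rename r M) e = eval M (fun x => e (r x)).
Proof.
elim: M r e => [x|P IHP Q IHQ|A P IHP] r e //=; first by rewrite IHP IHQ.
have E a : eval (rename (up_ren r) P) (scons a e)
         = eval P (scons a (fun x => e (r x))).
  by rewrite IHP; congr eval; apply: functional_extensionality; case.
rewrite E; congr (mkval _).
by apply: functional_extensionality => a; rewrite E.
Qed.

Lemma eval_substitute M s e :
  eval (substitute s M) e = eval M (fun x => eval (s x) e).
Proof.
elim: M s e => [x|P IHP Q IHQ|A P IHP] s e //=; first by rewrite IHP IHQ.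
have E a : eval (substitute (up_sub s) P) (scons a e)
         = eval P (scons a (fun x => eval (s x) e)).
  rewrite IHP; congr eval; apply: functional_extensionality.
  by case=> //= x; rewrite eval_rename.
rewrite E; congr (mkval _).
by apply: functional_extensionality => a; rewrite E.
Qed.

Lemma eval_substitute0 M N e :
  eval (substitute0 M N) e = eval M (scons (eval N e) e).
Proof.
by rewrite eval_substitute; congr eval; apply: functional_extensionality; case.
Qed.

(** * Typing and invariance of values under reduction *)

Definition env_typed (G : context) (e : nat -> val) : Prop :=
  forall x A, lookup G x = Some A -> val_type (e x) = A.

Lemma env_typed_cons G e A (a : den A) :
  env_typed G e -> env_typed (Some A :: G) (scons (mkval a) e).
Proof. by move=> He [|x] B; [case=> <- | apply: He]. Qed.

Lemma env_typed_nil e : env_typed [::] e.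
Proof. by case. Qed.

Lemma env_typed_exists G : exists e, env_typed G e.
Proof.
exists (fun x => mkval (dflt (if lookup G x is Some A then A else Base))).
by move=> x A ->.
Qed.

Lemma eval_type G M A e :
  has_type G M A -> env_typed G e -> val_type (eval M e) = A.
Proof.
move=> HM; elim: HM e => {G M A}
  [G x A Hx|G M N A B _ IHM _ _|G A M B _ IHM] e He /=; first exact: He.
  by move: (IHM _ He); case: (eval M e) => C f /= EC; move: f; rewrite EC.
by rewrite /val_type /= [projT1 _](IHM _ (env_typed_cons _ He)).
Qed.

Lemma has_type_rename G D r M A :
    (forall x B, lookup G x = Some B -> lookup D (r x) = Some B) ->
  has_type G M A -> has_type D (rename r M) A.
Proof.
move=> Hr HM; elim: HM D r Hr => {G M A}
  [G x A Hx|G M N A B _ IHM _ IHN|G A M B _ IHM] D r Hr /=.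
- exact/ht_var/Hr.
- by apply: ht_app; [apply: IHM Hr | apply: IHN].
- by apply/ht_lam/IHM; case=> //= x C; apply: Hr.
Qed.

Lemma has_type_substitute G D s M A :
    (forall x B, lookup G x = Some B -> has_type D (s x) B) ->
  has_type G M A -> has_type D (substitute s M) A.
Proof.
move=> Hs HM; elim: HM D s Hs => {G M A}
  [G x A Hx|G M N A B _ IHM _ IHN|G A M B _ IHM] D s Hs /=.
- exact: Hs.
- by apply: ht_app; [apply: IHM Hs | apply: IHN].
- apply/ht_lam/IHM => -[|x] C /= Hx; first exact: ht_var.
  exact: has_type_rename (Hs _ _ Hx).
Qed.

Lemma has_type_app_inv G M N B :
  has_type G (App M N) B -> exists2 A, has_type G M (Arr A B) & has_type G N A.
Proof. by move=> H; inversion H; subst; eexists; eassumption. Qed.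

Lemma has_type_lam_inv G A M T :
  has_type G (Lam A M) T -> exists2 B, T = Arr A B & has_type (Some A :: G) M B.
Proof. by move=> H; inversion H; subst; eexists; first reflexivity. Qed.

Lemma subject_reduction G M N A :
  beta_step M N -> has_type G M A -> has_type G N A.
Proof.
move=> S; elim: S G A => {M N}
  [B M N|M M' N _ IH|M N N' _ IH|B M M' _ IH] G A.
- case/has_type_app_inv=> _ /has_type_lam_inv[_ [-> <-] HM] HN.
  apply: has_type_substitute HM.
  by case=> [|x] C /= => [[<-]|Hx] //; apply: ht_var.
- by case/has_type_app_inv=> C /IH; apply: ht_app.
- by case/has_type_app_inv=> C HM /IH; apply: ht_app.
- by case/has_type_lam_inv=> C -> /IH; apply: ht_lam.
Qed.

(** Typing matters: in an ill-typed redex [coerce] would replace the argument by a default value,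
    whereas substitution keeps it. *)
Lemma eval_beta_step G M N A e :
  beta_step M N -> has_type G M A -> env_typed G e -> eval M e = eval N e.
Proof.
move=> S; elim: S G A e => {M N}
  [B M N|M M' N _ IH|M N N' _ IH|B M M' _ IH] G A e.
- case/has_type_app_inv=> _ /has_type_lam_inv[_ [-> <-] HM] HN He.
  rewrite eval_substitute0 /= (mkval_coerce (eval_type HN He)).
  (* The body has the same type at every argument, so the type read off at the default is the right
     one. *)
  have Ht a := eval_type HM (env_typed_cons a He).
  by rewrite Ht mkval_coerce // -(mkval_coerce (eval_type HN He)) Ht.
- by case/has_type_app_inv=> C HM _ He /=; rewrite (IH _ _ _ HM He).
- by case/has_type_app_inv=> C _ HN He /=; rewrite (IH _ _ _ HN He).
- case/has_type_lam_inv=> C _ HM He.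
  have E a := IH _ _ _ HM (env_typed_cons a He).
  rewrite /= E; congr (mkval _).
  by apply: functional_extensionality => a; rewrite E.
Qed.

Lemma eval_beta_reduces G M N A e :
  beta_reduces M N -> has_type G M A -> env_typed G e -> eval M e = eval N e.
Proof.
move=> S HM He.
suff: eval M e = eval N e /\ has_type G N A by case.
elim: S HM => {M N} [M N S|M|M N P _ IH1 _ IH2] HM //.
  by split; [apply: eval_beta_step S HM He | apply: subject_reduction S HM].
by case: (IH1 HM) => -> /IH2.
Qed.

(** * The two-world logical relation *)

(* A safe argument of order at least 1 has no free ground variable, hence is
   related at every world; a ground argument only at the current world. *)
Definition upto (c : bool) (A : type) (P : bool -> Prop) : Prop :=
  if ord A is 0 then P c else forall c', P c'.

Fixpoint rel (c : bool) (A : type) : den A -> den A -> Prop :=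
  match A with
  | Base => fun a b => b = a (+) c
  | Arr B C => fun f g =>
      forall a b, upto c B (fun c' => rel c' a b) -> rel c (f a) (g b)
  end.

Definition vrel (c : bool) (A : type) (v w : val) : Prop :=
  rel c (coerce A v) (coerce A w).

Fixpoint free (x : nat) (M : term) : bool :=
  match M with
  | Var y => x == y
  | App P Q => free x P || free x Q
  | Lam _ P => free x.+1 P
  end.

Lemma free_declared G M A x :
  has_type G M A -> free x M -> lookup G x <> None.
Proof.
move=> HM; elim: HM x => {G M A}
  [G y A Hy|G M N A B _ IHM _ IHN|G A M B _ IHM] x /=.
- by move/eqP->; rewrite Hy.
- by case/orP; [apply: IHM | apply: IHN].
- exact: IHM.
Qed.

(* Only free variables are constrained, because some types, such as
   (o -> o) -> o, have no element related to itself at every world. *)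
Definition env_rel (c : bool) (G : context) (M : term) (e e' : nat -> val) :=
  forall x A, free x M -> lookup G x = Some A ->
    upto c A (fun c' => vrel c' A (e x) (e' x)).

Lemma upto_here c A (P : bool -> Prop) : upto c A P -> P c.
Proof. by rewrite /upto; case: (ord A). Qed.

(** This is where the order condition of safety acts. If [A] has positive order, so has every
    variable of [G], and then [env_rel] is the same condition at all worlds; at order 0 only world
    [c] is asked for. *)
Lemma upto_intro c A G M e e' (P : bool -> Prop) :
    le_ord_ctx (ord A) G -> env_rel c G M e e' ->
    (forall c', env_rel c' G M e e' -> P c') ->
  upto c A P.
Proof.
rewrite /upto; case: (ord A) => [|k] HG He HP; first exact: HP.
move=> c'; apply: HP => x B Hx HB.
by move: (He x B Hx HB) (HG x B HB); rewrite /upto; case: (ord B).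
Qed.

(** * The fundamental lemma for safe terms *)

Lemma extend_cons G A As : extend G (A :: As) = extend (Some A :: G) As.
Proof. by rewrite /extend rev_cons map_rcons cat_rcons. Qed.

Lemma has_type_lams G As M B :
  has_type (extend G As) M B -> has_type G (lams As M) (arrs As B).
Proof.
elim: As G => [|A As IH] G //; rewrite extend_cons => HM.
exact/ht_lam/IH.
Qed.

Lemma lookup_singleton x A : lookup (singleton_ctx x A) x = Some A.
Proof. by rewrite /lookup nth_rcons size_nseq ltnn eqxx. Qed.

Scheme safe_mut := Induction for safe Sort Prop
  with asafe_mut := Induction for asafe Sort Prop.
Combined Scheme safe_asafe_ind from safe_mut, asafe_mut.

Lemma safe_asafe_has_type :
  (forall G M A, safe G M A -> has_type G M A) /\
  (forall G M A, asafe G M A -> has_type G M A).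
Proof.
apply: safe_asafe_ind.
- by move=> x A; apply/ht_var/lookup_singleton.
- move=> G D M A _ HM GD; elim: HM D GD => {G M A}
    [G x A Hx|G M N A B _ IHM _ IHN|G A M B _ IHM] D GD.
  + exact/ht_var/GD.
  + by apply: ht_app; [apply: IHM | apply: IHN].
  + by apply/ht_lam/IHM; case=> //= x C; apply: GD.
- by move=> G M N A B _ HM _ HN _; apply: ht_app HM HN.
- by move=> G As M B _ HM _; apply: has_type_lams.
- by [].
- by move=> G M N A B _ HM _ HN; apply: ht_app HM HN.
Qed.

Lemma vrel_apply c A B v v' w w' :
    val_type v = Arr A B -> val_type v' = Arr A B ->
    vrel c (Arr A B) v v' -> upto c A (fun c' => vrel c' A w w') ->
  vrel c B (apply v w) (apply v' w').
Proof.
case: v v' => [T f] [T' f'] /= ET ET'; subst.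
by rewrite /vrel !coerce_mkval => Hf Hw; apply: Hf.
Qed.

(** The hypothesis on the body ranges over all environments for the full context, so that it
    survives the induction, which adds one binder at a time. *)
Lemma vrel_lams c G As M B e e' :
    has_type (extend G As) M B -> env_typed G e -> env_typed G e' ->
    env_rel c G (lams As M) e e' ->
    (forall d d', env_typed (extend G As) d -> env_typed (extend G As) d' ->
       env_rel c (extend G As) M d d' -> vrel c B (eval M d) (eval M d')) ->
  vrel c (arrs As B) (eval (lams As M) e) (eval (lams As M) e').
Proof.
elim: As G e e' => [|A As IH] G e e'; first by move=> _ He He' Hr; apply.
rewrite extend_cons => HM He He' Hr Hbody.
have Ht f (a : den A) (Hf : env_typed G f) :=
  eval_type (has_type_lams HM) (env_typed_cons a Hf).
rewrite /vrel /= !Ht // !coerce_mkval => a b Hab.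
apply: IH (env_typed_cons _ He) (env_typed_cons _ He') _ Hbody => // -[|x] C Hx /=.
  by case=> <-; rewrite /vrel !coerce_mkval.
exact: Hr.
Qed.

(** An almost safe term may have ground free variables whatever its order, so it is related only at
    the current world. Arguments are safe, which gives the [upto] that [rel] demands at arrow
    types. *)
Lemma fundamental :
  (forall G M A, safe G M A -> forall c e e',
     env_typed G e -> env_typed G e' -> env_rel c G M e e' ->
     upto c A (fun c' => vrel c' A (eval M e) (eval M e'))) /\
  (forall G M A, asafe G M A -> forall c e e',
     env_typed G e -> env_typed G e' -> env_rel c G M e e' ->
     vrel c A (eval M e) (eval M e')).
Proof.
have [_ asafe_type] := safe_asafe_has_type.
have app_case G M N A B c e e' :
    asafe G M (Arr A B) -> env_typed G e -> env_typed G e' ->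
    env_rel c G (App M N) e e' ->
    (env_rel c G M e e' -> vrel c (Arr A B) (eval M e) (eval M e')) ->
    (env_rel c G N e e' -> upto c A (fun c' => vrel c' A (eval N e) (eval N e'))) ->
  vrel c B (eval (App M N) e) (eval (App M N) e').
  move=> /asafe_type HM He He' Hr IHM IHN.
  apply: (@vrel_apply c A B); rewrite ?(eval_type HM) //.
    by apply: IHM => x C Hx; apply: Hr; rewrite /= Hx.
  by apply: IHN => x C Hx; apply: Hr; rewrite /= Hx orbT.
apply: safe_asafe_ind.
- by move=> x A c e e' _ _; apply; [exact: eqxx | exact: lookup_singleton].
- move=> G D M A _ IH GD c e e' He He' Hr.
  apply: IH => [x B /GD|x B /GD|x B Hx /GD]; [exact: He|exact: He'|exact: Hr].
- move=> G M N A B HM IHM _ IHN HG c e e' He He' Hr.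
  apply: (upto_intro HG Hr) => c' Hr'.
  by apply: app_case HM He He' Hr' (IHM _ _ _ He He') (IHN _ _ _ He He').
- move=> G As M B HM IH HG c e e' He He' Hr.
  apply: (upto_intro HG Hr) => c' Hr'.
  by apply: vrel_lams (asafe_type _ _ _ HM) He He' Hr' _ => d d'; apply: IH.
- by move=> G M A _ IH c e e' He He' Hr; apply: (upto_here (IH _ _ _ He He' Hr)).
- move=> G M N A B HM IHM _ IHN c e e' He He' Hr.
  by apply: app_case HM He He' Hr (IHM _ _ _ He He') (IHN _ _ _ He He').
Qed.

Lemma safe_closed_rel C A :
    has_type [::] C A -> safe_term C ->
  exists e, forall c, vrel c A (eval C e) (eval C e).
Proof.
move=> HC [G [B HB]]; have [e He] := env_typed_exists G; exists e => c.
(* Safety may hold in another context and, a priori, at another type; evaluation in an environment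
   typed for both contexts identifies the types. *)
have <- : B = A.
  rewrite -(eval_type HC (env_typed_nil e)).
  by rewrite (eval_type (safe_asafe_has_type.1 _ _ _ HB) He).
apply: upto_here (fundamental.1 _ _ _ HB c _ _ He He _) => x D Hx.
by have := free_declared HC Hx; rewrite /lookup nth_nil.
Qed.

(** * Numerals in the model and the contradiction *)

Definition numeral_den (n : nat) : den nat_type := fun s z => iter n s z.

Lemma eval_numeral n e : eval (numeral n) e = mkval (numeral_den n).
Proof.
have E (s : den (Arr Base Base)) (z : den Base) :
    eval (iter n (App (Var 1)) (Var 0)) (scons (mkval z) (scons (mkval s) e))
    = @mkval Base (iter n s z).
  by elim: n => //= n ->; rewrite /= coerce_mkval.
rewrite /numeral /= !E; congr (@mkval nat_type _).
apply: functional_extensionality => s; rewrite E /= coerce_mkval.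
by apply: functional_extensionality => z; rewrite E coerce_mkval.
Qed.

Lemma has_type_numeral G n : has_type G (numeral n) nat_type.
Proof.
apply/ht_lam/ht_lam; elim: n => [|n IH]; first exact: ht_var.
by apply: ht_app IH; apply: ht_var.
Qed.

(** Related [f] and [g] coincide and commute with negation, so both add the constant [f false]
    modulo 2, and their iterates depend only on parity. *)
Lemma rel_numeral c m n :
  odd m = odd n -> rel c (numeral_den m) (numeral_den n).
Proof.
move=> Emn f g Hfg a b /= ->.
(* The type [o -> o] has order 1, so [Hfg] is available at both worlds. *)
have Hf c' x : g (x (+) c') = f x (+) c' by apply: Hfg.
have Eg x : g x = x (+) f false.
  by case: x; [have := Hf true false | have := Hf false false];
     rewrite /= => ->; case: (f false).
have Ef x : f x = x (+) f false by rewrite -Eg -[x in g x]addbF Hf addbF.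
have iterE h k x : (forall y, h y = y (+) f false) ->
    iter k h x = x (+) (odd k && f false).
  move=> Hh; elim: k => [|k IH] /=; first by rewrite addbF.
  by rewrite Hh IH -addbA; case: (odd k) (f false) => [] [].
by rewrite /numeral_den (iterE g) // (iterE f) // Emn addbAC.
Qed.

Theorem corollary2p3 :
  ~ (exists C : term,
      [/\ has_type [::] C (arrs [:: nat_type; nat_type; nat_type] nat_type),
          safe_term C
        & forall (G : context) (t y z : term),
            has_type G t nat_type ->
            has_type G y nat_type ->
            has_type G z nat_type ->
            (beta_reduces t (numeral 0) ->
               beta_reduces (App (App (App C t) y) z) y) /\
            ((exists n : nat, beta_reduces t (numeral n.+1)) ->
               beta_reduces (App (App (App C t) y) z) z)]).
Proof.
case=> C [HC /(safe_closed_rel HC) [e HR] Hcond].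
pose num n := mkval (numeral_den n).
(* With 0 and 1 as branches, the boolean [n != 0], read as a number, is the numeral selected. *)
have cond_val n :
    apply (apply (apply (eval C e) (num n)) (num 0)) (num 1) = num (n != 0).
  have HN k := has_type_numeral [::] k.
  have HT : has_type [::] (App (App (App C (numeral n)) (numeral 0)) (numeral 1))
      nat_type.
    by do 3![apply: ht_app (HN _)]; apply: HC.
  have [H0 HS] := Hcond [::] _ _ _ (HN n) (HN 0) (HN 1).
  rewrite /num -!(eval_numeral _ e); apply: eval_beta_reduces HT (env_typed_nil e).
  case: n H0 HS => [|n] H0 HS; first by apply: H0; apply: rt_refl.
  by apply: HS; exists n; apply: rt_refl.
have {HR} := HR false; have := eval_type HC (env_typed_nil e).
move: (cond_val 0) (cond_val 2); rewrite /num.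
case: (eval C e) => T F /= E0 E2 ET; subst T.
move: E0 E2; rewrite /= !coerce_mkval /vrel !coerce_mkval => E0 E2 HF.
have HN m n : odd m = odd n -> upto false nat_type
    (fun c => rel c (numeral_den m) (numeral_den n)).
  by move=> Emn c; apply: rel_numeral.
have := HF _ _ (HN 0 2 erefl) _ _ (HN 0 0 erefl) _ _ (HN 1 1 erefl).
(* Coercing both sides turns an equality of dependent pairs into one of their second components. *)
move/(congr1 (coerce nat_type)): E0; rewrite !coerce_mkval => ->.
move/(congr1 (coerce nat_type)): E2; rewrite !coerce_mkval => ->.
have negb_rel c : @rel c (Arr Base Base) negb negb.
  by move=> a _ /= ->; case: a c => [] [].
(* At [negb] and [true], numeral 0 yields [true] and numeral 1 yields [false], but world [false]
   demands equality. *)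
by move/(_ negb negb negb_rel true true erefl).
Qed.
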